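(* Let $q\in[0,1)$. A $\mathbb C^{n\times m}$-valued function $T$ analytic at the origin is $q$-rational if and only if $T$ is the $q$-Borel transform of a $\mathbb C^{n\times m}$-valued rational function $F$ analytic at the origin, i.e. $T(z)=\sum_{k=0}^\infty\frac{z^k}{[k]_q!}F_k$ where $F(z)=\sum_{k=0}^\infty z^kF_k$.
   Context: $[0]_q=1$, $[k]_q=1+q+\cdots+q^{k-1}$ ($k\ge1$), $[k]_q!=\prod_{j=1}^k[j]_q$, $[0]_q!=1$. A $\mathbb C^{n\times m}$-valued function $T$ analytic at the origin is called $q$-rational if there exist $N\in\mathbb N_0$ and $(C,A,B)\in\mathbb C^{n\times N}\times\mathbb C^{N\times N}\times\mathbb C^{N\times m}$ such that $T(z)=C\prod_{j=0}^\infty(I_N-(1-q)zq^jA)^{-1}B$ in a neighbourhood of the origin (convention $q^0=1$). *)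

(* Defs.v *)
From HB Require Import structures.
From mathcomp Require Import all_boot all_order all_algebra.
From mathcomp Require Import complex.
From mathcomp Require Import all_classical all_reals all_analysis.
Import Order.TTheory GRing.Theory Num.Theory.
Import numFieldNormedType.Exports.
Set Implicit Arguments. Unset Strict Implicit. Unset Printing Implicit Defensive.
Local Open Scope ring_scope.
Local Open Scope complex_scope.
Local Open Scope classical_set_scope.

Section QRational.
Variable R : realType.
Local Notation C := R[i].

(* [k]_q, with the paper's convention [0]_q = 1 *)
Definition qint (q : R) (k : nat) : R :=
  if k is 0 then 1 else \sum_(i < k) q ^+ i.

Definition qfact (q : R) (k : nat) : R := \prod_(j < k) qint q j.+1.

Variables n m : nat.

Definition mx_cvg (p r : nat) (u : nat -> 'M[C]_(p, r)) (L : 'M[C]_(p, r)) : Prop :=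
  forall (i : 'I_p) (j : 'I_r) (e : C), 0 < e ->
    exists K : nat, forall k : nat, (K <= k)%N -> `|u k i j - L i j| < e.

Definition mx_series_to (c : nat -> 'M[C]_(n, m)) (z : C) (L : 'M[C]_(n, m)) : Prop :=
  mx_cvg (fun K => \sum_(k < K) (z ^+ k) *: c k) L.

Definition near0 (P : C -> Prop) : Prop :=
  exists r : C, 0 < r /\ forall z : C, `|z| < r -> P z.

Definition analytic_at0 (T : C -> 'M[C]_(n, m)) : Prop :=
  exists c : nat -> 'M[C]_(n, m), near0 (fun z => mx_series_to c z (T z)).

Definition q_rational (q : R) (T : C -> 'M[C]_(n, m)) : Prop :=
  exists (N : nat) (Cm : 'M[C]_(n, N)) (A : 'M[C]_N) (B : 'M[C]_(N, m)),
    near0 (fun z =>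
      (forall j : nat, (1%:M - (((1 - q) * q ^+ j)%:C * z) *: A) \in unitmx) /\
      exists P : 'M[C]_N,
        mx_cvg (fun J => \prod_(j < J) invmx (1%:M - (((1 - q) * q ^+ j)%:C * z) *: A)) P
        /\ T z = Cm *m P *m B).

Definition is_rational_fun (F : C -> 'M[C]_(n, m)) : Prop :=
  exists (P : 'M[{poly C}]_(n, m)) (d : {poly C}), d != 0 /\
    forall z : C, d.[z] != 0 -> F z = (d.[z])^-1 *: map_mx (fun p => p.[z]) P.

End QRational.

(* Main.v *)
(** Put [E(w) = \sum_k w^k A^k / [k]_q!]. Comparing coefficients gives
    [(1 - (1 - q) w A) E(w) = E(q w)], hence
    [\prod_(j < J) (1 - (1 - q) q^j z A)^-1 * E(q^J z) = E(z)]; as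
    [E(q^J z) -> E(0) = 1], the infinite product equals [E(z)] for small [z]. So
    the q-rational functions are the q-Borel transforms of the power series
    [\sum_k z^k C A^k B]. The functional equation for [q = 0] identifies such a
    series with [C (1 - z A)^-1 B], which is rational by Cramer's rule;
    conversely, clearing denominators in a rational function analytic at 0 shows
    that its Taylor coefficients satisfy a linear recurrence, so they have the
    form [C A^k B]. *)

Require Import Defs.
From HB Require Import structures.
From mathcomp Require Import all_boot all_order all_algebra.
From mathcomp Require Import complex ring zify.
From mathcomp Require Import all_classical all_reals all_analysis.
Import Order.TTheory GRing.Theory Num.Theory.
Import numFieldNormedType.Exports.
Set Implicit Arguments. Unset Strict Implicit. Unset Printing Implicit Defensive.
Local Open Scope ring_scope.
Local Open Scope complex_scope.
Local Open Scope classical_set_scope.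

Section MatrixTopology.
Variable K : numFieldType.
Variables (I : Type) (F : set_system I).
Context {FF : Filter F}.

Lemma cvg_mxP p r (u : I -> 'M[K]_(p, r)) (U : 'M[K]_(p, r)) :
  u @ F --> U <-> forall i j, u x i j @[x --> F] --> U i j.
Proof.
split=> [uU i j|uU]; first exact: cvg_comp uU (@coord_continuous K p r i j U).
apply/cvg_mx_entourageP => A entA.
apply: filter_forall => i; apply: filter_forall => j.
have /cvg_app_entourageP/(_ A entA) := uU i j.
by apply: filterS => x /=; rewrite inE.
Qed.

Lemma cvg_mulmx p r s (u : I -> 'M[K]_(p, r)) (v : I -> 'M[K]_(r, s))
    (U : 'M[K]_(p, r)) (V : 'M[K]_(r, s)) :
  u @ F --> U -> v @ F --> V -> u x *m v x @[x --> F] --> U *m V.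
Proof.
move=> /cvg_mxP uU /cvg_mxP vV; apply/cvg_mxP => i j; rewrite mxE.
under eq_fun do rewrite mxE.
by apply: cvg_big => [|k _]; [exact: add_continuous | exact: cvgM].
Qed.

Lemma cvg_det p (u : I -> 'M[K]_p) (U : 'M[K]_p) :
  u @ F --> U -> \det (u x) @[x --> F] --> \det U.
Proof.
move=> /cvg_mxP uU; apply: cvg_big => [|s _]; first exact: add_continuous.
apply: cvgM; first exact: cvg_cst.
by apply: cvg_big => // ; exact: mul_continuous.
Qed.

Lemma cvg_adj p (u : I -> 'M[K]_p) (U : 'M[K]_p) :
  u @ F --> U -> \adj (u x) @[x --> F] --> \adj U.
Proof.
move=> /cvg_mxP uU; apply/cvg_mxP => i j; rewrite mxE.
under eq_fun do rewrite mxE.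
apply: cvgM; first exact: cvg_cst.
apply: cvg_det; apply/cvg_mxP => k l; rewrite !mxE.
by rewrite [X in X @ _](_ : _ = fun x => u x (lift j k) (lift i l)) //;
  apply/funext => x; rewrite !mxE.
Qed.

Lemma near_unitmx p (u : I -> 'M[K]_p) (U : 'M[K]_p) : U \in unitmx ->
  u @ F --> U -> \forall x \near F, u x \in unitmx.
Proof.
rewrite unitmxE unitfE => detU uU.
have : \forall x \near F, \det (u x) != 0.
  by apply: cvgr_neq0 detU; exact: cvg_det.
by apply: filterS => x; rewrite unitmxE unitfE.
Qed.

Lemma cvg_invmx p (u : I -> 'M[K]_p) (U : 'M[K]_p) : U \in unitmx ->
  u @ F --> U -> invmx (u x) @[x --> F] --> invmx U.
Proof.
move=> Uunit uU; rewrite {2}/invmx Uunit.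
apply: (@cvg_trans _ ((\det (u x))^-1 *: \adj (u x) @[x --> F])).
  apply: near_eq_cvg; apply: filterS (near_unitmx Uunit uU) => x ux.
  by rewrite /invmx ux.
apply: cvgZ; last exact: cvg_adj.
by apply: cvgV; [rewrite -unitfE -unitmxE | exact: cvg_det].
Qed.

Lemma cvg_mulmx_cancelr p r (u : I -> 'M[K]_(p, r)) (v : I -> 'M[K]_r)
    (V : 'M[K]_r) (W : 'M[K]_(p, r)) : V \in unitmx ->
  v @ F --> V -> u x *m v x @[x --> F] --> W -> u @ F --> W *m invmx V.
Proof.
move=> Vunit vV uvW; apply: cvg_trans (cvg_mulmx uvW (cvg_invmx Vunit vV)).
apply: near_eq_cvg; apply: filterS (near_unitmx Vunit vV) => x vx.
by rewrite mulmxK.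
Qed.

End MatrixTopology.

Section MatrixNorm.
Variable K : numFieldType.

Lemma coord_le_mx_norm p r (A : 'M[K]_(p, r)) i j : `|A i j| <= `|A|.
Proof.
rewrite [leRHS]/Num.Def.normr /= mx_normE.
exact: (le_bigmax _ (fun ij : 'I_p * 'I_r => `|A ij.1 ij.2|%:nng) (i, j)).
Qed.

Lemma mx_norm_le p r (A : 'M[K]_(p, r)) (b : K) : 0 <= b ->
  (forall i j, `|A i j| <= b) -> `|A| <= b.
Proof.
move=> b0 Ab; rewrite [leLHS]/Num.Def.normr /=.
have [->|/mx_norm_neq0 [[i j] ->]] := eqVneq (mx_norm A) 0; first exact: b0.
exact: Ab.
Qed.

Lemma mx_norm_mulmx p r s (A : 'M[K]_(p, r)) (B : 'M[K]_(r, s)) :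
  `|A *m B| <= r%:R * `|A| * `|B|.
Proof.
apply: mx_norm_le => [|i j]; first by rewrite !mulr_ge0.
rewrite mxE (le_trans (ler_norm_sum _ _ _)) //.
have -> : r%:R * `|A| * `|B| = \sum_(k < r) `|A| * `|B|.
  by rewrite sumr_const card_ord -[RHS]mulr_natl mulrA.
by apply: ler_sum => k _; rewrite normrM ler_pM ?coord_le_mx_norm.
Qed.

(* The factor [p] makes the sup norm submultiplicative. *)
Definition mulmx_norm p (A : 'M[K]_p) : K := p%:R * `|A|.

Lemma mulmx_norm_ge0 p (A : 'M[K]_p) : 0 <= mulmx_norm A.
Proof. by rewrite mulr_ge0. Qed.

Lemma mulmx_normZ p a (A : 'M[K]_p) : mulmx_norm (a *: A) = `|a| * mulmx_norm A.
Proof. by rewrite /mulmx_norm normrZ mulrCA. Qed.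

Lemma near_mulmx_norm_lt1 p (A : 'M[K]_p) :
  \forall z \near (0 : K), `|z| * mulmx_norm A < 1.
Proof.
have normA1_gt0 : 0 < mulmx_norm A + 1 by rewrite ltr_wpDl ?mulmx_norm_ge0.
have : \forall z \near (0 : K), `|z| < (mulmx_norm A + 1)^-1.
  by apply: nbhs0_lt; rewrite invr_gt0.
apply: filterS => z; rewrite -[_^-1]mul1r ltr_pdivlMr //.
by apply: le_lt_trans; rewrite ler_wpM2l // lerDl.
Qed.

Lemma mulmx_norm_lt1M p (A : 'M[K]_p) a z : `|a| <= 1 ->
  `|z| * mulmx_norm A < 1 -> `|a * z| * mulmx_norm A < 1.
Proof.
move=> a1; apply: le_lt_trans; rewrite normrM -mulrA.
by rewrite ler_piMl ?mulr_ge0 ?mulmx_norm_ge0.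
Qed.

Lemma mx_norm_expr_le p (A : 'M[K]_p) k : `|A ^+ k| <= mulmx_norm A ^+ k.
Proof.
elim: k => [|k IH].
  rewrite !expr0; apply: mx_norm_le => // i j; rewrite mxE.
  by case: eqP => _; rewrite ?normr1 ?normr0.
rewrite !exprS (le_trans (mx_norm_mulmx _ _)) // -/(mulmx_norm A).
by rewrite ler_wpM2l ?mulmx_norm_ge0.
Qed.

Lemma unitmx_1B p (A : 'M[K]_p) : mulmx_norm A < 1 -> 1%:M - A \in unitmx.
Proof.
move=> normA_lt1; rewrite -row_free_unit -kermx_eq0; set N := kermx _.
have /eqP : N *m (1%:M - A) = 0 := mulmx_ker _.
rewrite mulmxBr mulmx1 subr_eq0 => /eqP NA.
apply: contraTT normA_lt1 => N0.
rewrite -real_leNgt ?ger0_real ?mulmx_norm_ge0 //.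
rewrite -(ler_pM2r (_ : 0 < `|N|)) ?normr_gt0 // mul1r {1}NA.
by rewrite (le_trans (mx_norm_mulmx _ _)) // /mulmx_norm mulrAC.
Qed.

Lemma unitmx_1BZ p (A : 'M[K]_p) z :
  `|z| * mulmx_norm A < 1 -> 1%:M - z *: A \in unitmx.
Proof. by move=> zA; apply: unitmx_1B; rewrite mulmx_normZ. Qed.

End MatrixNorm.

Section PolyConvolution.
Variables (K : fieldType) (V : lmodType K).
Implicit Types (c : nat -> V) (d : {poly K}).

Definition poly_conv d c k : V := \sum_(i < k.+1) d`_i *: c (k - i)%N.

Definition shift_coef c k : V := if k is k'.+1 then c k' else 0.

(* As in [companionmx], the last entry of [a] stands for the leading coefficient
   [1] and is ignored. *)
Definition linear_recurrence (a : seq K) c : Prop :=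
  forall l,
    c (l + (size a).-1)%N = - \sum_(j < (size a).-1) a`_j *: c (l + j)%N.

Lemma poly_conv0 c k : poly_conv 0 c k = 0.
Proof. by rewrite /poly_conv big1 // => i _; rewrite coef0 scale0r. Qed.

Lemma poly_convMXaddC d a c k :
  poly_conv (d * 'X + a%:P) c k = shift_coef (poly_conv d c) k + a *: c k.
Proof.
rewrite /poly_conv big_ord_recl coefD coefMX coefC !eqxx add0r subn0 addrC.
congr (_ + _); case: k => [|k]; first by rewrite big_ord0.
by apply: eq_bigr => i _; rewrite coefD coefMX coefC addr0.
Qed.

Lemma poly_convMXn d c s k : poly_conv (d * 'X^s) c (k + s)%N = poly_conv d c k.
Proof.
elim: s => [|s IH]; first by rewrite expr0 mulr1 addn0.
by rewrite exprSr mulrA -[_ * 'X]addr0 poly_convMXaddC scale0r addr0 addnS.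
Qed.

Lemma poly_conv_recurrence d c M : d`_0 != 0 ->
  (forall k, (M <= k)%N -> poly_conv d c k = 0) ->
  exists2 a : seq K, (1 < size a)%N & linear_recurrence a c.
Proof.
move=> d0 dc0; pose p := maxn (size d) M.
have [dp Mp] : (size d <= p)%N /\ (M <= p)%N by rewrite leq_maxl leq_maxr.
exists (mkseq (fun j => d`_(p.+1 - j) / d`_0) p.+2).
  by rewrite size_mkseq.
rewrite /linear_recurrence size_mkseq => l.
have /dc0 : (M <= l + p.+1)%N by lia.
rewrite /poly_conv (_ : (l + p.+1).+1 = p.+2 + l)%N; last by lia.
rewrite big_split_ord /= addrC big1 => [|i _]; last first.
  by rewrite nth_default ?scale0r // (leq_trans dp) //= !addSn !leqW ?leq_addr.
rewrite add0r big_ord_recl subn0 => /eqP; rewrite addr_eq0 => /eqP.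
move=> /(canRL (scalerK d0)) ->; rewrite scalerN scaler_sumr; congr (- _).
rewrite (reindex_inj rev_ord_inj) /=; apply: eq_bigr => j _.
have jp := ltn_ord j; rewrite [(mkseq _ _)`_j]nth_mkseq; last exact: ltnW.
rewrite scalerA mulrC.
by congr ((d`_ _ / _) *: c _); rewrite /bump /=; lia.
Qed.

End PolyConvolution.

Section PowerSeries.
Variables (K : numFieldType) (V : normedModType K).
Implicit Types (c : nat -> V) (z : K) (d : {poly K}).

Definition powser c z : V^nat := fun n => \sum_(k < n) z ^+ k *: c k.

Lemma powser_recl c z n :
  powser c z n.+1 = c 0%N + z *: powser (fun k => c k.+1) z n.
Proof.
rewrite /powser big_ord_recl expr0 scale1r scaler_sumr.
by congr (_ + _); apply: eq_bigr => k _; rewrite scalerA -exprS.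
Qed.

Lemma powserM a c z : powser (fun k => a ^+ k *: c k) z = powser c (a * z).
Proof.
apply/funext => n; apply: eq_bigr => k _.
by rewrite /= scalerA -exprMn mulrC.
Qed.

Lemma cvg_powserD c c' z L L' :
  powser c z @ \oo --> L -> powser c' z @ \oo --> L' ->
  powser (fun k => c k + c' k) z @ \oo --> L + L'.
Proof.
move=> cL c'L'.
rewrite (_ : powser _ z = fun n => powser c z n + powser c' z n).
  exact: cvgD.
apply/funext => n; rewrite -big_split.
by apply: eq_bigr => k _; rewrite scalerDr.
Qed.

Lemma cvg_powserZ a c z L :
  powser c z @ \oo --> L -> powser (fun k => a *: c k) z @ \oo --> a *: L.
Proof.
move=> cL; rewrite (_ : powser _ z = fun n => a *: powser c z n).
  exact: cvgZ (cvg_cst a) cL.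
apply/funext => n; rewrite scaler_sumr.
by apply: eq_bigr => k _; rewrite !scalerA mulrC.
Qed.

Lemma cvg_powser_shift c z L :
  powser c z @ \oo --> L -> powser (shift_coef c) z @ \oo --> z *: L.
Proof.
move=> cL; rewrite -cvg_shiftS; under eq_fun do rewrite powser_recl add0r.
exact: cvgZ (cvg_cst z) cL.
Qed.

Lemma cvg_powser_unshift c z L : z != 0 -> powser c z @ \oo --> L ->
  powser (fun k => c k.+1) z @ \oo --> z^-1 *: (L - c 0%N).
Proof.
move=> z0; rewrite -cvg_shiftS => cL.
rewrite (_ : powser _ z = fun n => z^-1 *: (powser c z n.+1 - c 0%N)).
  exact: cvgZ (cvg_cst z^-1) (cvgB cL (cvg_cst (c 0%N))).
by apply/funext => n; rewrite powser_recl addrC addKr scalerK.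
Qed.

Lemma cvg_powser0 c : powser c 0 @ \oo --> c 0%N.
Proof.
rewrite -cvg_shiftS; under eq_fun do rewrite powser_recl scale0r addr0.
exact: cvg_cst.
Qed.

Lemma norm_powser_le c z b s n : 0 <= s -> `|z| * s <= 2^-1 ->
  (forall k, `|c k| <= b * s ^+ k) -> `|powser c z n| <= b * 2.
Proof.
move=> s0 zs cb; have zs0 : 0 <= `|z| * s by rewrite mulr_ge0.
have b0 : 0 <= b by have := cb 0%N; rewrite expr0 mulr1; apply: le_trans.
have half_gt0 : 0 < 2^-1 :> K by rewrite invr_gt0.
have sum_le2 : \sum_(k < n) (`|z| * s) ^+ k <= 2.
  have zs_lt1 : 0 < 1 - `|z| * s.
    by rewrite subr_gt0 (le_lt_trans zs) // invf_lt1 // ltr1n.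
  rewrite -(ler_pM2l zs_lt1) -[leLHS]opprK -mulNr opprB -subrX1 opprB.
  apply: (@le_trans _ _ 1); first by rewrite gerBl exprn_ge0.
  by rewrite -ler_pdivrMr // mul1r lerBrDr [leRHS]splitr mul1r lerD2l.
apply: le_trans (ler_wpM2l b0 sum_le2).
rewrite mulr_sumr (le_trans (ler_norm_sum _ _ _)) // ler_sum // => k _.
by rewrite normrZ normrX exprMn mulrCA ler_wpM2l ?exprn_ge0.
Qed.

Lemma norm_cvg_le (u : V^nat) (L : V) (b : K) :
  (forall n, `|u n| <= b) -> u @ \oo --> L -> `|L| <= b.
Proof.
move=> ub /cvgrPdist_lt uL; apply/ler_addgt0Pr => e /uL.
move=> [n _ /(_ n (leqnn n)) un].
rewrite -[L](subrK (u n)) addrC.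
by rewrite (le_trans (ler_normD _ _)) // lerD // ltW.
Qed.

Lemma powser_coef_bounded c z : z != 0 -> cvgn (powser c z) ->
  exists2 b : K, 0 < b & forall k, `|c k| <= b * `|z|^-1 ^+ k.
Proof.
move=> z0 cz.
have : cvgn (series (fun k => z ^+ k *: c k)) by rewrite seriesEord.
move=> /cvg_series_cvg_0/cvgP/cvg_seq_bounded/pinfty_ex_gt0 [b b0 zcb].
exists b => // k.
rewrite exprVn ler_pdivlMr; last by rewrite exprn_gt0 ?normr_gt0.
by rewrite mulrC -normrX -normrZ zcb.
Qed.

Lemma powser_dist_coef0_le c z b s L : 0 <= s -> `|z| * s <= 2^-1 ->
  (forall k, `|c k| <= b * s ^+ k) -> powser c z @ \oo --> L ->
  `|L - c 0%N| <= `|z| * (b * s * 2).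
Proof.
move=> s0 zs cb; rewrite -cvg_shiftS => cL.
have : powser c z n.+1 - c 0%N @[n --> \oo] --> L - c 0%N.
  exact: cvgB cL (cvg_cst (c 0%N)).
apply: norm_cvg_le => n; rewrite powser_recl addrC addKr normrZ ler_wpM2l //.
by apply: (norm_powser_le _ s0) => // k; rewrite -mulrA -exprS.
Qed.

Lemma cvg_powser_dnbhs0 c (f : K -> V) :
  (\forall z \near 0^', powser c z @ \oo --> f z) -> f z @[z --> 0^'] --> c 0%N.
Proof.
move=> cf; have [b [s [s0 b0 cb]]] :
    exists b s : K, [/\ 0 < s, 0 < b & forall k, `|c k| <= b * s ^+ k].
  near (0 : K)^' => z; have z0 : z != 0 by near: z; exact: nbhs_dnbhs_neq.
  have [|b b0 cb] := @powser_coef_bounded c z z0; last first.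
    by exists b, `|z|^-1; rewrite invr_gt0 normr_gt0.
  by apply/cvg_ex; exists (f z); near: z; exact: cf.
have C_gt0 : 0 < b * s * 2 by rewrite !mulr_gt0.
apply/cvgrPdistC_le => e e0; near=> z.
have cz : powser c z @ \oo --> f z by near: z; exact: cf.
apply: le_trans (powser_dist_coef0_le (ltW s0) _ cb cz) _.
  rewrite -ler_pdivlMr //; near: z; apply: dnbhs0_le.
  by rewrite divr_gt0 // invr_gt0.
rewrite -ler_pdivlMr //; near: z; apply: dnbhs0_le.
by rewrite divr_gt0.
Unshelve. all: by end_near. Qed.

Lemma powser_coef_eq0 c :
  (\forall z \near 0^', powser c z @ \oo --> (0 : V)) -> forall k, c k = 0.
Proof.
have coef0_eq0 c' :
    (\forall z \near 0^', powser c' z @ \oo --> (0 : V)) -> c' 0%N = 0.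
  move=> /cvg_powser_dnbhs0 c'0; apply: norm_cvg_unique c'0 _; exact: cvg_cst.
move=> + k; elim: k c => [|k IH] c c0; first exact: coef0_eq0.
apply: (IH (fun k => c k.+1)); near=> z.
have -> : 0 = z^-1 *: (0 - c 0%N) by rewrite coef0_eq0 // subrr scaler0.
by apply: cvg_powser_unshift; near: z; [exact: nbhs_dnbhs_neq | exact: c0].
Unshelve. all: by end_near. Qed.

Lemma cvg_powser_poly_conv d c z L :
  powser c z @ \oo --> L -> powser (poly_conv d c) z @ \oo --> d.[z] *: L.
Proof.
move=> cL; elim/poly_ind: d => [|d a IH].
  rewrite horner0 scale0r; apply: cvg_near_cst; apply: nearW => n.
  by rewrite /powser big1 // => k _; rewrite poly_conv0 scaler0.
rewrite hornerMXaddC scalerDl [_ * z]mulrC -scalerA.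
rewrite (_ : poly_conv _ _ = fun k => shift_coef (poly_conv d c) k + a *: c k).
  exact: cvg_powserD (cvg_powser_shift IH) (cvg_powserZ cL).
by apply/funext => k; rewrite poly_convMXaddC.
Qed.

End PowerSeries.

Section PowerSeriesMulmx.
Variables (K : numFieldType) (p r s : nat).

Lemma cvg_powser_mulmxl (M : 'M[K]_(p, r)) (c : nat -> 'M[K]_(r, s)) z
    (L : 'M[K]_(r, s)) :
  powser c z @ \oo --> L -> powser (fun k => M *m c k) z @ \oo --> M *m L.
Proof.
move=> cL; rewrite (_ : powser _ z = fun n => M *m powser c z n).
  exact: cvg_mulmx (cvg_cst M) cL.
apply/funext => n; rewrite mulmx_sumr.
by apply: eq_bigr => k _; rewrite scalemxAr.
Qed.

Lemma cvg_powser_mulmxr (c : nat -> 'M[K]_(p, r)) (M : 'M[K]_(r, s)) z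
    (L : 'M[K]_(p, r)) :
  powser c z @ \oo --> L -> powser (fun k => c k *m M) z @ \oo --> L *m M.
Proof.
move=> cL; rewrite (_ : powser _ z = fun n => powser c z n *m M).
  exact: cvg_mulmx cL (cvg_cst M).
apply/funext => n; rewrite mulmx_suml.
by apply: eq_bigr => k _; rewrite scalemxAl.
Qed.

End PowerSeriesMulmx.

Section RationalSeries.
Variable K : numFieldType.
Implicit Type d : {poly K}.

Lemma horner_continuous d : continuous (horner d).
Proof.
move=> x; elim/poly_ind: d => [|d a IH].
  rewrite (_ : horner 0 = cst 0); first exact: cst_continuous.
  by apply/funext => z; rewrite horner0.
rewrite (_ : horner (d * 'X + a%:P) = fun z => d.[z] * z + a).
  exact: cvgD (cvgM IH cvg_id) (cvg_cst a).
by apply/funext => z; rewrite hornerMXaddC.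
Qed.

Lemma poly_factor_Xn d : d != 0 ->
  exists s (d' : {poly K}), d = d' * 'X^s /\ d'`_0 != 0.
Proof.
move=> d0; have [s [d' d'0 ->]] := multiplicity_XsubC d 0.
exists s, d'; rewrite subr0; split=> //.
by rewrite -horner_coef0; move: d'0; rewrite d0.
Qed.

Lemma near_dnbhs0_horner_neq0 d : d != 0 -> \forall z \near 0^', d.[z] != 0.
Proof.
move=> /poly_factor_Xn [s [d' [-> d'0]]]; rewrite -horner_coef0 in d'0.
have d'z : \forall z \near 0^', d'.[z] != 0.
  by apply: nbhs_dnbhs; exact: cvgr_neq0 (@horner_continuous d' 0) d'0.
near=> z; rewrite hornerM hornerXn mulf_neq0 //; first by near: z.
by rewrite expf_neq0 //; near: z; exact: nbhs_dnbhs_neq.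
Unshelve. all: by end_near. Qed.

Variables n m : nat.
Implicit Type P : 'M[{poly K}]_(n, m).

Definition polymx_size P : nat := \max_i \max_j size (P i j).

Lemma size_polymx_le P i j : (size (P i j) <= polymx_size P)%N.
Proof.
apply: leq_trans (leq_bigmax i).
exact: (leq_bigmax (F := fun j => size (P i j))).
Qed.

Lemma cvg_powser_polymx P z :
  powser (fun k => map_mx (coefp k) P) z @ \oo --> map_mx (horner_eval z) P.
Proof.
apply: cvg_near_cst; exists (polymx_size P) => // k /= sk.
apply/matrixP => i j; rewrite summxE mxE /horner_eval (@horner_coef_wide _ k).
  by apply: eq_bigr => l _; rewrite !mxE mulrC.
exact: leq_trans (size_polymx_le P i j) sk.
Qed.

(* Both sides of [d F = P] are power series that agree near [0], except perhaps
   at [0] itself. *)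
Lemma rational_poly_conv (F : K -> 'M[K]_(n, m)) (c : nat -> 'M[K]_(n, m)) P d :
  d != 0 ->
  (forall z, d.[z] != 0 -> F z = (d.[z])^-1 *: map_mx (horner_eval z) P) ->
  (\forall z \near 0, powser c z @ \oo --> F z) ->
  forall k, poly_conv d c k = map_mx (coefp k) P.
Proof.
move=> d0 FP cF k; apply/eqP; rewrite -subr_eq0 -scaleN1r; apply/eqP; move: k.
apply: powser_coef_eq0; near=> z.
have -> : 0 = d.[z] *: F z + -1 *: map_mx (horner_eval z) P.
  have dz : d.[z] != 0 by near: z; exact: near_dnbhs0_horner_neq0.
  by rewrite FP // scalerA divff // scale1r scaleN1r subrr.
apply: cvg_powserD; last exact/cvg_powserZ/cvg_powser_polymx.
by apply: cvg_powser_poly_conv; near: z; exact: nbhs_dnbhs.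
Unshelve. all: by end_near. Qed.

End RationalSeries.

Section Realization.
Variable K : fieldType.

Definition realizable n m (F : nat -> 'M[K]_(n, m)) : Prop :=
  exists (N : nat) (Cm : 'M[K]_(n, N)) (A : 'M[K]_N) (B : 'M[K]_(N, m)),
    forall k, F k = Cm *m A ^+ k *m B.

Lemma realizable0 n m : realizable (fun=> 0 : 'M[K]_(n, m)).
Proof. by exists 0%N, 0, 0, 0 => k; rewrite mulmx0. Qed.

Lemma expr_block_diag_mx N1 N2 (A1 : 'M[K]_N1) (A2 : 'M[K]_N2) k :
  block_mx A1 0 0 A2 ^+ k = block_mx (A1 ^+ k) 0 0 (A2 ^+ k).
Proof.
elim: k => [|k IH]; first by rewrite !expr0 -scalar_mx_block.
rewrite !exprS IH -[LHS]/(_ *m _) mulmx_block.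
by rewrite !mulmx0 !mul0mx !addr0 !add0r.
Qed.

Lemma realizableD n m (F G : nat -> 'M[K]_(n, m)) :
  realizable F -> realizable G -> realizable (fun k => F k + G k).
Proof.
move=> [N1 [C1 [A1 [B1 FE]]]] [N2 [C2 [A2 [B2 GE]]]].
exists (N1 + N2)%N, (row_mx C1 C2), (block_mx A1 0 0 A2), (col_mx B1 B2) => k.
rewrite expr_block_diag_mx mul_row_block !mulmx0 addr0 add0r mul_row_col.
by rewrite FE GE.
Qed.

Lemma realizable_sum n m I (s : seq I) (F : I -> nat -> 'M[K]_(n, m)) :
  (forall i, realizable (F i)) -> realizable (fun k => \sum_(i <- s) F i k).
Proof.
move=> Freal; elim: s => [|i s IH].
  by under eq_fun do rewrite big_nil; exact: realizable0.
by under eq_fun do rewrite big_cons; exact: realizableD.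
Qed.

Lemma realizable_mul n m p r (L : 'M[K]_(p, n)) (M : 'M[K]_(m, r))
    (F : nat -> 'M[K]_(n, m)) :
  realizable F -> realizable (fun k => L *m F k *m M).
Proof.
move=> [N [Cm [A [B FE]]]]; exists N, (L *m Cm), A, (B *m M) => k.
by rewrite FE !mulmxA.
Qed.

Lemma realizable_entries n m (F : nat -> 'M[K]_(n, m)) :
  (forall i j, realizable (fun k => (F k i j)%:M : 'M[K]_1)) -> realizable F.
Proof.
move=> Freal.
rewrite (_ : F = fun k => \sum_i \sum_j
    delta_mx i (0 : 'I_1) *m (F k i j)%:M *m delta_mx (0 : 'I_1) j).
  by do 2![apply: realizable_sum => ?]; exact: realizable_mul.
apply/funext => k; rewrite [LHS]matrix_sum_delta.
apply: eq_bigr => i _; apply: eq_bigr => j _.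
by rewrite mul_mx_scalar -scalemxAl mul_delta_mx.
Qed.

Lemma companionmx_expr (a : seq K) (f : nat -> K^o) : linear_recurrence a f ->
  forall k, companionmx a ^+ k *m (\col_i f i) = \col_i f (k + i)%N.
Proof.
move=> rec; elim=> [|k IH]; first by rewrite mul1mx.
rewrite exprS -mulmxA IH; apply/matrixP => i j; rewrite !mxE.
have d_gt0 : (0 < (size a).-1)%N := leq_ltn_trans (leq0n i) (ltn_ord i).
have [iE|i_neq] := eqVneq (i : nat) (size a).-1.-1.
  rewrite addSnnS iE prednK // rec -sumrN; apply: eq_bigr => l _.
  by rewrite !mxE iE eqxx mulNr.
have iS_lt : (i.+1 < (size a).-1)%N.
  by rewrite -ltn_predRL ltn_neqAle i_neq -ltnS prednK ?ltn_ord.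
rewrite (bigD1 (Ordinal iS_lt)) //= big1 => [|l li].
  by rewrite !mxE (negPf i_neq) eqxx mul1r addr0 addnS.
rewrite !mxE (negPf i_neq); case: eqP => [il|_]; last by rewrite mul0r.
by case/eqP: li; apply/val_inj.
Qed.

Lemma realizable_recurrence n m (F : nat -> 'M[K]_(n, m)) (a : seq K) :
  (1 < size a)%N -> linear_recurrence a F -> realizable F.
Proof.
move=> size_a rec; apply: realizable_entries => i j.
have d_gt0 : (0 < (size a).-1)%N by rewrite -subn1 subn_gt0.
exists (size a).-1, (delta_mx 0 (Ordinal d_gt0)), (companionmx a).
exists (\col_k F k i j) => k.
rewrite -mulmxA (@companionmx_expr _ (fun k => F k i j)) => [|l].
  by rewrite -rowE; apply/matrixP => r s; rewrite !mxE !ord1 eqxx addn0.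
by rewrite rec mxE summxE; congr (- _); apply: eq_bigr => r _; rewrite mxE.
Qed.

End Realization.

Lemma rational_realizable (K : numFieldType) n m (F : K -> 'M[K]_(n, m))
    (c : nat -> 'M[K]_(n, m)) (P : 'M[{poly K}]_(n, m)) (d : {poly K}) :
  d != 0 ->
  (forall z, d.[z] != 0 -> F z = (d.[z])^-1 *: map_mx (horner_eval z) P) ->
  (\forall z \near 0, powser c z @ \oo --> F z) -> realizable c.
Proof.
move=> d0 FP cF; have [s [d' [dE d'0]]] := poly_factor_Xn d0.
have convE k : poly_conv d' c k = map_mx (coefp (k + s)) P.
  by rewrite -(rational_poly_conv d0 FP cF) dE poly_convMXn.
have [|a size_a rec] := @poly_conv_recurrence _ _ d' c (polymx_size P) d'0.
  move=> k sk; rewrite convE; apply/matrixP => i j.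
  rewrite !mxE /= nth_default //.
  by rewrite (leq_trans (size_polymx_le P i j)) // (leq_trans sk) ?leq_addr.
exact: realizable_recurrence size_a rec.
Qed.

Section Resolvent.
Variables (K : fieldType) (n m N : nat).
Variables (Cm : 'M[K]_(n, N)) (A : 'M[K]_N) (B : 'M[K]_(N, m)).

Definition resolvent_den : {poly K} := \det (1%:M - 'X *: map_mx polyC A).

Definition resolvent_num : 'M[{poly K}]_(n, m) :=
  map_mx polyC Cm *m \adj (1%:M - 'X *: map_mx polyC A) *m map_mx polyC B.

Lemma map_horner_pencil z :
  map_mx (horner_eval z) (1%:M - 'X *: map_mx polyC A) = 1%:M - z *: A.
Proof.
apply/matrixP => i j; rewrite !mxE /horner_eval !hornerE.
by case: (i == j); rewrite ?hornerE.
Qed.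

Lemma map_horner_polyC p r (X : 'M[K]_(p, r)) z :
  map_mx (horner_eval z) (map_mx polyC X) = X.
Proof. by apply/matrixP => i j; rewrite !mxE /horner_eval hornerC. Qed.

Lemma horner_resolvent_den z : resolvent_den.[z] = \det (1%:M - z *: A).
Proof. by rewrite -/(horner_eval z _) -det_map_mx map_horner_pencil. Qed.

Lemma horner_resolvent_num z :
  map_mx (horner_eval z) resolvent_num = Cm *m \adj (1%:M - z *: A) *m B.
Proof. by rewrite !map_mxM map_mx_adj map_horner_pencil !map_horner_polyC. Qed.

Lemma resolventE z : 1%:M - z *: A \in unitmx ->
  Cm *m invmx (1%:M - z *: A) *m B =
  resolvent_den.[z]^-1 *: map_mx (horner_eval z) resolvent_num.
Proof.
move=> zA; rewrite horner_resolvent_den horner_resolvent_num /invmx zA.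
by rewrite -scalemxAr -scalemxAl.
Qed.

Lemma resolvent_den_neq0 : resolvent_den != 0.
Proof.
apply/eqP => den0; have := horner_resolvent_den 0.
by rewrite den0 horner0 scale0r subr0 det1 => /esym/eqP; rewrite oner_eq0.
Qed.

End Resolvent.

Section ComplexTopology.
Variable R : realType.

HB.instance Definition _ := NormedModule.copy R[i] R[i]^o.

Lemma near0P (P : R[i] -> Prop) : near0 P <-> \forall z \near 0, P z.
Proof.
split=> [[r [r0 Pr]]|/nbhs_norm0P [r /= r0 Pr]]; last by exists r.
by apply/nbhs_norm0P; exists r.
Qed.

Lemma mx_cvgP p r (u : nat -> 'M[R[i]]_(p, r)) (L : 'M[R[i]]_(p, r)) :
  mx_cvg u L <-> u @ \oo --> L.
Proof.
split=> [uL|/cvg_mxP uL i j e e0].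
  apply/cvg_mxP => i j; apply/cvgrPdistC_lt => e /(uL i j) [k uLe].
  by exists k => // l /uLe.
by have /cvgrPdistC_lt/(_ e e0) [k _ uLe] := uL i j; exists k.
Qed.

Lemma mx_series_toP n m (c : nat -> 'M[R[i]]_(n, m)) z (L : 'M[R[i]]_(n, m)) :
  mx_series_to c z L <-> powser c z @ \oo --> L.
Proof. exact: mx_cvgP. Qed.

Lemma real_complex_continuous : continuous (fun x : R => x%:C).
Proof.
move=> x; apply/cvgrPdist_lt => e; rewrite ltcE => /andP [/eqP eR e0].
have : \forall y \near x, `|x - y| < complex.Re e.
  by have /cvgrPdist_lt := @cvg_id _ (nbhs x); apply.
apply: filterS => y; rewrite -rmorphB normc_def /= expr0n addr0 sqrtr_sqr.
by rewrite ltcE /= eR eqxx.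
Qed.

Lemma norm_real_complex_le1 (a : R) : 0 <= a <= 1 -> `|a%:C| <= 1.
Proof. by move=> /andP [a0 a1]; rewrite ger0_norm lecR. Qed.

Lemma normc_ge_Im (x : R[i]) : `|complex.Im x|%:C <= `|x|.
Proof.
rewrite -normrN -ReiNIm (le_trans (normc_ge_Re _)) // normrM.
by rewrite [`|'i%C|]normc_def /= expr0n expr1n add0r sqrtr1 mulr1.
Qed.

Lemma is_cvg_series_dominated (V : completeNormedModType R) (u : V^nat)
    (v : R^nat) : cvgn (series v) ->
  (forall k, `|u k| <= v k) -> cvgn (series u).
Proof.
move=> cv uv; apply: normed_cvg; apply: series_le_cvg cv => k /=.
- exact: normr_ge0.
- exact: le_trans (normr_ge0 _) (uv k).
- exact: uv.
Qed.

Lemma is_cvg_series_complex_dominated (u : R[i]^nat) (v : R^nat) :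
  cvgn (series v) -> (forall k, `|u k| <= (v k)%:C) -> cvgn (series u).
Proof.
move=> cv uv.
have /cvg_ex [/= a aE] : cvgn (series (fun k => complex.Re (u k))).
  apply: is_cvg_series_dominated cv _ => k.
  by rewrite -lecR (le_trans (normc_ge_Re _)).
have /cvg_ex [/= b bE] : cvgn (series (fun k => complex.Im (u k))).
  apply: is_cvg_series_dominated cv _ => k.
  by rewrite -lecR (le_trans (normc_ge_Im _)).
apply/cvg_ex; exists (a%:C + 'i%C * b%:C).
rewrite (_ : series u = fun n => (series (fun k => complex.Re (u k)) n)%:C +
    'i%C * (series (fun k => complex.Im (u k)) n)%:C).
  have reE := cvg_comp _ _ aE (@real_complex_continuous a).
  have imE := cvg_comp _ _ bE (@real_complex_continuous b).
  exact: (cvgD reE (cvgM (cvg_cst 'i%C) imE)).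
apply/funext => n; rewrite [LHS]complexE /series /=.
by rewrite (raddf_sum (@complex.Re R)) (raddf_sum (@complex.Im R)).
Qed.

Lemma is_cvg_series_mx_dominated p r (u : nat -> 'M[R[i]]_(p, r)) (v : R^nat) :
  cvgn (series v) -> (forall k, `|u k| <= (v k)%:C) -> cvgn (series u).
Proof.
move=> cv uv.
have cu i j : cvgn (series (fun k => u k i j)).
  apply: is_cvg_series_complex_dominated cv _ => k.
  exact: le_trans (coord_le_mx_norm _ _ _) (uv k).
apply/cvg_ex; exists (\matrix_(i, j) limn (series (fun k => u k i j))).
apply/cvg_mxP => i j; rewrite mxE.
rewrite (_ : (fun _ => _) = series (fun k => u k i j)); first exact: cu.
by apply/funext => n; rewrite /series /= summxE.
Qed.

Lemma is_cvg_powser_geometric p r (c : nat -> 'M[R[i]]_(p, r)) (s z : R[i]) :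
  0 <= s -> (forall k, `|c k| <= s ^+ k) -> `|z| * s < 1 -> cvgn (powser c z).
Proof.
move=> s0 cs zs1; pose x := complex.Re (`|z| * s).
have xE : x%:C = `|z| * s by rewrite RRe_real // ger0_real // mulr_ge0.
have x0 : 0 <= x by rewrite -lecR xE mulr_ge0.
have x1 : x < 1 by rewrite -ltcR xE.
have -> : powser c z = series (fun k => z ^+ k *: c k) by rewrite seriesEord.
apply: (@is_cvg_series_mx_dominated _ _ _ (geometric 1 x)).
  by apply: is_cvg_geometric_series; rewrite ger0_norm.
move=> k; rewrite /= mul1r rmorphXn /= xE exprMn normrZ normrX.
by rewrite ler_wpM2l ?exprn_ge0.
Qed.

End ComplexTopology.

Section QExponential.
Variables (R : realType) (q : R).
Hypotheses (q_ge0 : 0 <= q) (q_lt1 : q < 1).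

Lemma qint_ge1 k : 1 <= qint q k.+1.
Proof.
by rewrite /qint big_ord_recl expr0 lerDl sumr_ge0 // => i _; rewrite exprn_ge0.
Qed.

Lemma qfact_ge1 k : 1 <= qfact q k.
Proof.
rewrite /qfact; elim/big_ind: _ => // [x y x1 y1|i _]; last exact: qint_ge1.
by rewrite -[1]mulr1 ler_pM.
Qed.

Lemma mul1B_qint k : (1 - q) * qint q k.+1 = 1 - q ^+ k.+1.
Proof. by rewrite /qint -[RHS]opprB subrX1 -mulNr opprB. Qed.

Lemma qfactV_rec k :
  (1 - q) * (qfact q k)^-1 = (1 - q ^+ k.+1) * (qfact q k.+1)^-1.
Proof.
rewrite -mul1B_qint {2}/qfact big_ord_recr /= -/(qfact q k).
have neq0 (x : R) : 1 <= x -> x != 0 by move=> /(lt_le_trans ltr01)/gt_eqF ->.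
by field; rewrite !neq0 ?qfact_ge1 ?qint_ge1.
Qed.

Lemma qfactV_itv01 k : 0 <= (qfact q k)^-1 <= 1.
Proof.
have qf0 : 0 < qfact q k := lt_le_trans ltr01 (qfact_ge1 k).
by rewrite invr_ge0 (ltW qf0) invf_le1 // qfact_ge1.
Qed.

Lemma expr_itv01 k : 0 <= q ^+ k <= 1.
Proof. by rewrite exprn_ge0 // exprn_ile1 // ltW. Qed.

Variables (N : nat) (A : 'M[R[i]]_N).

Definition qexp_coef k : 'M[R[i]]_N := ((qfact q k)^-1)%:C *: A ^+ k.

(* A junk value where the series diverges. *)
Definition qexp z : 'M[R[i]]_N := limn (powser qexp_coef z).

Definition qexp_factor z j : 'M[R[i]]_N :=
  1%:M - (((1 - q) * q ^+ j)%:C * z) *: A.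

Lemma qexp_coef0 : qexp_coef 0 = 1%:M.
Proof. by rewrite /qexp_coef /qfact big_ord0 invr1 scale1r expr0. Qed.

Lemma qexp_coef_rec k : q%:C ^+ k *: qexp_coef k =
  qexp_coef k + - (1 - q)%:C *: (A *m shift_coef qexp_coef k).
Proof.
case: k => [|k]; first by rewrite expr0 scale1r mulmx0 scaler0 addr0.
rewrite /= /qexp_coef -scalemxAr -[A *m _]exprS !scalerA -scalerDl.
congr (_ *: _); rewrite mulNr -rmorphM qfactV_rec.
rewrite -rmorphXn -!rmorphM -rmorphB /=.
by congr (_%:C); ring.
Qed.

Lemma norm_qexp_coef_le k : `|qexp_coef k| <= mulmx_norm A ^+ k.
Proof.
rewrite normrZ (le_trans _ (mx_norm_expr_le A k)) //.
by rewrite ler_piMl // norm_real_complex_le1 // qfactV_itv01.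
Qed.

Lemma cvg_powser_qexp z : `|z| * mulmx_norm A < 1 ->
  powser qexp_coef z @ \oo --> qexp z.
Proof.
exact: is_cvg_powser_geometric (mulmx_norm_ge0 A) norm_qexp_coef_le.
Qed.

Lemma qexp0 : qexp 0 = 1%:M.
Proof. rewrite -qexp_coef0; exact: cvg_lim (@cvg_powser0 _ _ _). Qed.

Lemma qexp_continuous0 : {for 0, continuous qexp}.
Proof.
apply/continuous_withinNx; rewrite qexp0 -qexp_coef0.
apply: cvg_powser_dnbhs0; apply: nbhs_dnbhs.
by apply: filterS (near_mulmx_norm_lt1 A) => z; exact: cvg_powser_qexp.
Qed.

Lemma qexp_functional_eq w : `|w| * mulmx_norm A < 1 ->
  (1%:M - ((1 - q)%:C * w) *: A) *m qexp w = qexp (q%:C * w).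
Proof.
move=> w_disk; have qw_disk : `|q%:C * w| * mulmx_norm A < 1.
  by apply: mulmx_norm_lt1M => //; rewrite norm_real_complex_le1 // q_ge0 ltW.
apply: norm_cvg_unique (cvg_powser_qexp qw_disk).
rewrite -powserM.
have -> : (1%:M - ((1 - q)%:C * w) *: A) *m qexp w =
    qexp w + - (1 - q)%:C *: (A *m (w *: qexp w)).
  by rewrite mulmxBl mul1mx -scalemxAl -scalemxAr scalerA mulNr scaleNr.
have -> : (fun k => q%:C ^+ k *: qexp_coef k) =
    fun k => qexp_coef k + - (1 - q)%:C *: (A *m shift_coef qexp_coef k).
  apply/funext => k; exact: qexp_coef_rec.
have Ew := cvg_powser_qexp w_disk.
exact: (cvg_powserD Ew (cvg_powserZ (cvg_powser_mulmxl (cvg_powser_shift Ew)))).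
Qed.

Lemma qexp_factor_unit z j :
  `|z| * mulmx_norm A < 1 -> qexp_factor z j \in unitmx.
Proof.
move=> z_disk; apply/unitmx_1BZ/mulmx_norm_lt1M => //.
have /andP [qj_ge0 qj_le1] := expr_itv01 j.
have q1_ge0 : 0 <= 1 - q by rewrite subr_ge0 ltW.
by rewrite norm_real_complex_le1 // mulr_ge0 // mulr_ile1 // gerBl.
Qed.

Lemma mul_qexp_prod z J : `|z| * mulmx_norm A < 1 ->
  (\prod_(j < J) invmx (qexp_factor z j)) *m qexp ((q ^+ J)%:C * z) = qexp z.
Proof.
move=> z_disk; elim: J => [|J IH]; first by rewrite big_ord0 mul1mx expr0 mul1r.
rewrite big_ord_recr /= -[_ * _ *m _]mulmxA -[RHS]IH; congr (_ *m _).
have qJ_disk : `|(q ^+ J)%:C * z| * mulmx_norm A < 1.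
  by apply: mulmx_norm_lt1M => //; rewrite norm_real_complex_le1 ?expr_itv01.
rewrite exprS rmorphM -mulrA -(qexp_functional_eq qJ_disk) mulrA -rmorphM.
exact: mulKmx (qexp_factor_unit J z_disk) _.
Qed.

Lemma cvg_qexp_prod z : `|z| * mulmx_norm A < 1 ->
  (\prod_(j < J) invmx (qexp_factor z j)) @[J --> \oo] --> qexp z.
Proof.
move=> z_disk; rewrite -[qexp z]mulmx1 -invmx1.
have qJz : ((q ^+ J)%:C * z) @[J --> \oo] --> (0 : R[i]).
  have qJ : (q ^+ J)%:C @[J --> \oo] --> (0 : R[i]).
    have qJ0 : q ^+ J @[J --> \oo] --> (0 : R).
      by apply: cvg_expr; rewrite ger0_norm.
    exact: cvg_comp _ _ qJ0 (@real_complex_continuous R 0).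
  rewrite -(mul0r z); exact: (cvgM qJ (cvg_cst z)).
have qexpJ : qexp ((q ^+ J)%:C * z) @[J --> \oo] --> (1%:M : 'M[R[i]]_N).
  rewrite -qexp0; exact: cvg_comp _ _ qJz qexp_continuous0.
apply: cvg_mulmx_cancelr (unitmx1 _ _) qexpJ _.
under eq_fun do rewrite mul_qexp_prod //.
exact: cvg_cst.
Qed.

End QExponential.

Section Characterizations.
Variables (R : realType) (n m : nat).
Implicit Types (c : nat -> 'M[R[i]]_(n, m)) (T F : R[i] -> 'M[R[i]]_(n, m)).

Definition q_borel (q : R) c k : 'M[R[i]]_(n, m) := ((qfact q k)^-1)%:C *: c k.

Lemma q_borel0 c : q_borel 0 c = c.
Proof.
apply/funext => k; rewrite /q_borel /qfact big1 ?invr1 ?scale1r // => j _.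
by rewrite /qint big_ord_recl expr0 big1 ?addr0 // => i _; rewrite exprS mul0r.
Qed.

Lemma cvg_powser_q_borel q N (Cm : 'M[R[i]]_(n, N)) (A : 'M[R[i]]_N)
    (B : 'M[R[i]]_(N, m)) z : 0 <= q -> `|z| * mulmx_norm A < 1 ->
  powser (q_borel q (fun k => Cm *m A ^+ k *m B)) z @ \oo -->
  Cm *m qexp q A z *m B.
Proof.
move=> q_ge0 z_disk.
rewrite (_ : q_borel _ _ = fun k => Cm *m qexp_coef q A k *m B).
  exact: cvg_powser_mulmxr (cvg_powser_mulmxl (cvg_powser_qexp q_ge0 z_disk)).
by apply/funext => k; rewrite /q_borel /qexp_coef -scalemxAr -scalemxAl.
Qed.

Lemma invmx_1BZ N (A : 'M[R[i]]_N) z : `|z| * mulmx_norm A < 1 ->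
  invmx (1%:M - z *: A) = qexp 0 A z.
Proof.
move=> z_disk; have := qexp_functional_eq (lexx 0) ltr01 z_disk.
rewrite subr0 !(mul1r, mul0r) qexp0 => E1.
by rewrite -(mulKmx (unitmx_1BZ z_disk) (qexp 0 A z)) E1 mulmx1.
Qed.

Lemma q_rationalP q T : 0 <= q -> q < 1 ->
  (q_rational q T <->
   exists2 c, realizable c &
     near0 (fun z => mx_series_to (q_borel q c) z (T z))).
Proof.
move=> q_ge0 q_lt1; split.
  move=> [N [Cm [A [B /near0P TE]]]].
  exists (fun k => Cm *m A ^+ k *m B); first by exists N, Cm, A, B.
  apply/near0P; apply: filterS2 TE (near_mulmx_norm_lt1 A) => z.
  move=> [_ [P [cvgP ->]]] z_disk; apply/mx_series_toP.
  rewrite -(_ : qexp q A z = P).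
    exact: cvg_powser_q_borel.
  by apply: norm_cvg_unique (cvg_qexp_prod q_ge0 q_lt1 z_disk) _; apply/mx_cvgP.
move=> [c [N [Cm [A [B cE]]]] /near0P cT]; exists N, Cm, A, B; apply/near0P.
apply: filterS2 cT (near_mulmx_norm_lt1 A) => z /mx_series_toP cTz z_disk.
split.
  by move=> j; exact: qexp_factor_unit.
exists (qexp q A z); split; first by apply/mx_cvgP; exact: cvg_qexp_prod.
apply: norm_cvg_unique cTz _; rewrite (funext cE).
exact: cvg_powser_q_borel.
Qed.

Lemma realizable_rationalP c :
  realizable c <->
  exists F, is_rational_fun F /\ near0 (fun z => mx_series_to c z (F z)).
Proof.
split=> [[N [Cm [A [B cE]]]]|[F [[P [d [d0 FP]]] /near0P cF]]]; last first.
  apply: (rational_realizable d0 FP).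
  by apply: filterS cF => z /mx_series_toP.
pose P := resolvent_num Cm A B; pose d := resolvent_den A.
exists (fun z => d.[z]^-1 *: map_mx (horner_eval z) P).
split; first by exists P, d; rewrite resolvent_den_neq0.
apply/near0P; apply: filterS (near_mulmx_norm_lt1 A) => z z_disk.
apply/mx_series_toP; rewrite -(resolventE _ _ (unitmx_1BZ z_disk)) invmx_1BZ //.
rewrite (funext cE) -[X in powser X]q_borel0.
exact: cvg_powser_q_borel (lexx 0) z_disk.
Qed.

End Characterizations.

Theorem theorem5p7 (R : realType) (n m : nat) (q : R)
    (T : R[i] -> 'M[R[i]]_(n, m)) :
  0 <= q -> q < 1 -> analytic_at0 T ->
  (q_rational q T <->
   exists F : R[i] -> 'M[R[i]]_(n, m),
     is_rational_fun F /\
     exists Fk : nat -> 'M[R[i]]_(n, m),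
       near0 (fun z => mx_series_to Fk z (F z)) /\
       near0 (fun z => mx_series_to (fun k => ((qfact q k)^-1)%:C *: Fk k) z (T z))).
Proof.
move=> q_ge0 q_lt1 _; rewrite q_rationalP //; split.
  move=> [Fk /realizable_rationalP [F [ratF cF]] cT].
  by exists F; split=> //; exists Fk.
move=> [F [ratF [Fk [cF cT]]]]; exists Fk => //.
by apply/realizable_rationalP; exists F.
Qed.
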